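(* Let $\mathcal{H}$ be a real Hilbert space, let $\mathcal{A}:\mathcal{H}\to 2^{\mathcal{H}}$ be an operator with $\operatorname{zer}\mathcal{A}\neq\emptyset$, and let $\mathcal{M}$ be an admissible preconditioner for $\mathcal{A}$ such that $\mathcal{M}^{-1}\mathcal{A}$ is $\mathcal{M}$-monotone and $(\mathcal{M}+\mathcal{A})^{-1}$ is $L$-Lipschitz. Put $\mathcal{T}=(\mathcal{M}+\mathcal{A})^{-1}\mathcal{M}$. Let $\{\lambda_k\}_{k\in\mathbb{N}}\subset[0,2]$ satisfy $\sum_{k}\lambda_k(2-\lambda_k)=+\infty$, let $u^0\in\mathcal{H}$, and let $u^{k+1}=u^k+\lambda_k(\mathcal{T}u^k-u^k)$ for all $k\in\mathbb{N}$. If every weak cluster point of $\{\mathcal{T}u^k\}_k$ lies in $\operatorname{Fix}\mathcal{T}$, then the sequence $\{\mathcal{T}u^k\}_k$ converges weakly in $\mathcal{H}$ to some $u^*\in\operatorname{Fix}\mathcal{T}$. Furthermore, if $0<\inf_k\lambda_k\le\sup_k\lambda_k<2$, then also the sequence $\{u^k\}_k$ converges weakly to $u^*$.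
   Context: A (possibly multivalued) operator $\mathcal{A}:\mathcal{H}\to2^{\mathcal{H}}$ is identified with its graph in $\mathcal{H}\times\mathcal{H}$; $\operatorname{zer}\mathcal{A}=\{u: 0\in\mathcal{A}u\}$; inverses are inverses of multivalued operators (relations). $\operatorname{Fix}\mathcal{T}$ is the set of fixed points of $\mathcal{T}$. An admissible preconditioner for $\mathcal{A}$ is a linear, bounded, self-adjoint, positive semi-definite operator $\mathcal{M}:\mathcal{H}\to\mathcal{H}$ such that $\mathcal{T}:=(\mathcal{M}+\mathcal{A})^{-1}\mathcal{M}$ is single-valued and has full domain. $\mathcal{M}$ may have a nontrivial kernel. $\mathcal{M}^{-1}\mathcal{A}$ is the multivalued operator with graph $\{(u,z): \mathcal{M}z\in\mathcal{A}u\}$. Put $\langle u,v\rangle_{\mathcal{M}}:=\langle\mathcal{M}u,v\rangle$. An operator $\mathcal{B}:\mathcal{H}\to2^{\mathcal{H}}$ is $\mathcal{M}$-monotone if $\langle v-v',u-u'\rangle_{\mathcal{M}}\ge0$ for all $(u,v),(u',v')\in\mathcal{B}$. $(\mathcal{M}+\mathcal{A})^{-1}$ being $L$-Lipschitz means $\|y-y'\|\le L\|x-x'\|$ for all $(x,y),(x',y')$ in its graph (so it is single-valued on its domain). *)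

(* Defs.v *)
From HB Require Import structures.
From mathcomp Require Import all_boot all_order all_algebra.
From mathcomp Require Import all_classical all_reals all_analysis.

Set Implicit Arguments.
Unset Strict Implicit.
Unset Printing Implicit Defensive.

Import Order.TTheory GRing.Theory Num.Theory.
Import numFieldNormedType.Exports.

Local Open Scope classical_set_scope.
Local Open Scope ring_scope.

(* A real Hilbert space is a complete normed module [H] with an inner product
   [dot] that induces its norm. *)
Definition hilbert_inner (R : realType) (H : completeNormedModType R)
    (dot : {dot H for (@idfun R)}) : Prop :=
  forall u, `|u| = Num.sqrt (dot u u).

Section WeakTopology.
Context (R : realType) (H : completeNormedModType R).
Variable dot : {dot H for (@idfun R)}.

(* The coarsest topology on [H] that makes every [dot ^~ v] continuous: the
   initial topology of [u |-> (dot u v)_v] into the product space R^H. By the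
   Riesz theorem it is the topology induced by the continuous dual. *)
Definition weak_topology : topologicalType :=
  initial_topology (fun u : H => (dot u : H -> R) : {ptws H -> R}).

Definition weak_cvg (x : nat -> H) (l : H) : Prop :=
  (x : nat -> weak_topology) @ \oo --> (l : weak_topology).

Definition weak_cluster (x : nat -> H) : set H :=
  cluster ((x : nat -> weak_topology) @ \oo).

Lemma weak_cvgP (x : nat -> H) (l : H) :
  weak_cvg x l <-> forall v, (fun k => dot (x k) v) @ \oo --> dot l v.
Proof.
pose f (u : H) : {ptws H -> R} := dot u.
split=> [xl v|xl].
  have fl : f \o x @ \oo --> f l.
    exact: (cvg_comp _ _ xl (@initial_continuous _ _ f l)).
  by have /pointwise_cvgP/(_ v) := fl.
move=> A; rewrite nbhsE => -[_ [[B oB <-] Bl] sBA].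
apply: (filterS sBA).
have : {ptws, f \o x @ \oo --> f l} by apply/pointwise_cvgP.
by apply; exact: open_nbhs_nbhs.
Qed.

End WeakTopology.

Section Operators.
Context (R : realType) (H : completeNormedModType R).
Implicit Types (A B : H -> set H) (M : H -> H).

Definition zer A : set H := [set u | A u 0].

Definition inv_op A : H -> set H := fun v => [set u | A u v].

Definition add_op M A : H -> set H := fun u => [set M u + a | a in A u].

Definition resolvent M A : H -> set H := inv_op (add_op M A).

Definition ppp_op M A : H -> set H := fun u => resolvent M A (M u).

(* M^-1 A; [M] need not be injective. *)
Definition pinv_op M A : H -> set H := fun u => [set z | A u (M z)].

Definition fix_set (T : H -> H) : set H := [set u | T u = u].

Definition lipschitz_op (L : R) A : Prop :=
  forall x y x' y', A x y -> A x' y' -> `|y - y'| <= L * `|x - x'|.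

Definition admissible (dot : {dot H for (@idfun R)}) (M : {linear H -> H})
    A : Prop :=
  [/\ exists C : R, forall u, `|M u| <= C * `|u|,
      forall u v, dot (M u) v = dot u (M v),
      forall u, 0 <= dot (M u) u &
      forall u, exists y, ppp_op M A u = [set y]].

Definition pmonotone (dot : {dot H for (@idfun R)}) M B : Prop :=
  forall u v u' v', B u v -> B u' v' -> 0 <= dot (M (v - v')) (u - u').

End Operators.

(* Main.v *)
Require Import Defs.
From mathcomp Require Import all_boot all_order all_algebra.
From mathcomp Require Import all_classical all_reals all_analysis.
From mathcomp Require Import ring lra.

(** The preconditioner [M] induces the seminorm of [mform u v = dot (M u) v].
    The hypothesis on [M^-1 A] says exactly that [T] is firmly nonexpansive
    for it ([ppp_firmly_nonexpansive]), so the classical analysis of the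
    relaxed iteration goes through with the seminorm in place of the norm:
    the distances of [u k] to each fixed point decrease ([iter_fejer]) and
    converge, and the residuals [T (u k) - u k] tend to 0 in the seminorm
    ([iter_residual_cvg0]), because they decrease and the sum of
    [lam k * (2 - lam k)] diverges.

    The seminorm sees neither boundedness nor separation of points. Both are
    recovered for the sequence [T (u k)] by the Lipschitz resolvent:
    [`|T x - T y| <= L * `|M (x - y)|], and [`|M z|] is controlled by the
    seminorm of [z] ([precond_norm_le]). Hence [T (u k)] is bounded in norm,
    and two fixed points at seminorm distance 0 are equal.

    Let [p] and [q] be weak cluster points of [T (u k)]. They are fixed, so
    the real sequence [mform (T (u k)) (p - q)] converges by Opial's argument
    ([iter_fixed_pair_cvg]); its limit is [mform p (p - q)] as well as
    [mform q (p - q)], so [p] and [q] are at seminorm distance 0 and are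
    equal. A bounded sequence with at most one weak cluster point converges
    weakly ([weak_cvg_unique_cluster]). This form of weak compactness of
    balls follows from Riesz representation, applied to limits along
    ultrafilters.

    For the last claim, the scalar sequence [dot (u k) v] is a relaxed
    average of the convergent sequence [dot (T (u k)) v] whose weights keep
    [`|1 - lam k|] below a constant [q < 1], so it has the same limit
    ([relaxed_average_cvg]). *)

Set Implicit Arguments.
Unset Strict Implicit.
Unset Printing Implicit Defensive.

Import Order.TTheory GRing.Theory Num.Theory.
Import numFieldNormedType.Exports.

Local Open Scope classical_set_scope.
Local Open Scope ring_scope.

(** * Positive semi-definite forms *)

Section PsdForm.
Context (R : realType) (V : lmodType R).
Implicit Types (B : V -> V -> R) (u v w : V).

(** A seminorm replaces the norm because the preconditioner may have a kernel:
    [B u u = 0] need not give [u = 0]. *)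
Definition psd_form B : Prop :=
  [/\ forall u v, B u v = B v u,
      forall a u v w, B (a *: u + v) w = a * B u w + B v w &
      forall u, 0 <= B u u].

Context (B : V -> V -> R) (hB : psd_form B).

Lemma psd_ge0 u : 0 <= B u u. Proof. by case: hB. Qed.

Lemma psdC u v : B u v = B v u. Proof. by case: hB. Qed.

Lemma psdPl a u v w : B (a *: u + v) w = a * B u w + B v w.
Proof. by case: hB. Qed.

Lemma psdDl u v w : B (u + v) w = B u w + B v w.
Proof. by rewrite -{1}[u]scale1r psdPl mul1r. Qed.

Lemma psd0l w : B 0 w = 0.
Proof. by apply: (@addrI _ (B 0 w)); rewrite -psdDl !addr0. Qed.

Lemma psdZl a u w : B (a *: u) w = a * B u w.
Proof. by rewrite -[a *: u]addr0 psdPl psd0l addr0. Qed.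

Lemma psdNl u w : B (- u) w = - B u w.
Proof. by rewrite -scaleN1r psdZl mulN1r. Qed.

Lemma psdDr u v w : B u (v + w) = B u v + B u w.
Proof. by rewrite psdC psdDl !(psdC u). Qed.

Lemma psdZr a u w : B w (a *: u) = a * B w u.
Proof. by rewrite psdC psdZl (psdC u). Qed.

Lemma psdNr u w : B w (- u) = - B w u.
Proof. by rewrite psdC psdNl (psdC u). Qed.

Definition psdE := (psdDl, psdDr, psdNl, psdNr, psdZl, psdZr).

(** The quadratic [t |-> B (u - t v) (u - t v)] is nonnegative, so its
    discriminant is not positive. *)
Lemma psd_cauchy_schwarz u v : (B u v) ^+ 2 <= B u u * B v v.
Proof.
have pos t : 0 <= B u u - 2 * t * B u v + t ^+ 2 * B v v.
  have := psd_ge0 (u - t *: v).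
  by rewrite !psdE (psdC v u); congr (_ <= _); ring.
have [v0|v0] := eqVneq (B v v) 0.
  (* [B v v = 0]: the quadratic is affine in [t] and bounded below. *)
  have [->|uv0] := eqVneq (B u v) 0; first by rewrite v0; lra.
  have := pos ((B u u + 1) / (2 * B u v)).
  suff -> : 2 * ((B u u + 1) / (2 * B u v)) * B u v = B u u + 1.
    rewrite v0; lra.
  by field.
have vp : 0 < B v v by rewrite lt_def v0 psd_ge0.
have := pos (B u v / B v v).
have -> : B u u - 2 * (B u v / B v v) * B u v + (B u v / B v v) ^+ 2 * B v v =
   B u u - (B u v) ^+ 2 / B v v by field.
by rewrite subr_ge0 ler_pdivrMr.
Qed.

End PsdForm.

(** * Relaxed iterations of firmly nonexpansive maps for a seminorm *)

Section FirmlyNonexpansive.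
Context (R : realType) (V : lmodType R) (B : V -> V -> R) (hB : psd_form B).
Context (T : V -> V).

Definition firmly_nonexpansive : Prop :=
  forall x y, 0 <= B (T x - T y) ((x - T x) - (y - T y)).

Hypothesis hT : firmly_nonexpansive.

(** Put [d = x - p] and [r = T x - x]. Firmness against [p] says
    [B d r <= - B r r], and the new error is [d + l r], whose square is
    [B d d + 2 l B d r + l^2 B r r]. *)
Lemma relaxed_step_fejer (l : R) (x p : V) : 0 <= l -> T p = p ->
  B (x + l *: (T x - x) - p) (x + l *: (T x - x) - p)
    + l * (2 - l) * B (T x - x) (T x - x) <= B (x - p) (x - p).
Proof.
move=> l0 Tp; have := hT x p; rewrite Tp subrr subr0.
set r := T x - x; set d := x - p.
have -> : x + l *: r - p = d + l *: r by rewrite addrAC.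
have -> : T x - p = d + r by rewrite [RHS]addrC subrKA.
have -> : x - T x = - r by rewrite opprB.
clearbody r d; rewrite !(psdE hB) (psdC hB r d) => h.
have := mulr_ge0 l0 h; lra.
Qed.

(** Firmness is applied to the two successive points [y] and [x], for which
    [T y - T x] is the change of the residual plus [l *: (T x - x)]. *)
Lemma relaxed_step_residual (l : R) (x y : V) : 0 <= l <= 2 ->
  y = x + l *: (T x - x) ->
  B (T y - y) (T y - y) <= B (T x - x) (T x - x).
Proof.
move=> /andP[l0 l2] yx.
have [l_eq0|l_neq0] := eqVneq l 0; first by rewrite yx l_eq0 scale0r addr0.
have lp : 0 < l by rewrite lt_def l_neq0.
have := hT y x.
set r := T x - x in yx *; set r' := T y - y.
have Ty : T y = y + r' by rewrite addrC subrK.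
have Tx : T x = x + r by rewrite addrC subrK.
clearbody r r'.
have -> : T y - T x = (r' - r) + l *: r.
  by rewrite Ty Tx yx opprD addrACA [x + _]addrC addrK addrC.
have -> : y - T y - (x - T x) = r - r'.
  by rewrite Ty Tx !opprD !opprK !addrA subrr add0r subrK addrC.
have := psd_ge0 hB (r' - r).
rewrite !(psdE hB) (psdC hB r r').
set a := B r r; set b := B r' r; set c := B r' r' => h1 h2.
(* With [q = c - 2 * b + a], the square of [r' - r], firmness reads
   [q <= l * (a - b)], so [l * (a - c) = 2 * l * (a - b) - l * q] is at least
   [(2 - l) * q]. *)
have q0 : 0 <= (2 - l) * (c - 2 * b + a) by apply: mulr_ge0; lra.
have : 0 <= l * (a - c) by lra.
by rewrite pmulr_rge0 // subr_ge0.
Qed.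

Context (lam : nat -> R) (hlam : forall k, 0 <= lam k <= 2).
Context (u : nat -> V) (hu : forall k, u k.+1 = u k + lam k *: (T (u k) - u k)).

Lemma iter_fejer_step p k : T p = p ->
  B (u k.+1 - p) (u k.+1 - p)
    + lam k * (2 - lam k) * B (T (u k) - u k) (T (u k) - u k)
  <= B (u k - p) (u k - p).
Proof.
move=> Tp; rewrite hu; apply: relaxed_step_fejer => //.
by have /andP[] := hlam k.
Qed.

Lemma relaxation_weight_ge0 k : 0 <= lam k * (2 - lam k).
Proof. by have /andP[? ?] := hlam k; rewrite mulr_ge0 ?subr_ge0. Qed.

Lemma iter_fejer p : T p = p ->
  nonincreasing_seq (fun k => B (u k - p) (u k - p)).
Proof.
move=> Tp; apply/nonincreasing_seqP => k; apply: le_trans (iter_fejer_step k Tp).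
by rewrite lerDl mulr_ge0 ?relaxation_weight_ge0 ?psd_ge0.
Qed.

Lemma iter_dist_cvg p : T p = p -> cvgn (fun k => B (u k - p) (u k - p)).
Proof.
move=> Tp; apply: nonincreasing_is_cvgn; first exact: iter_fejer.
by exists 0 => _ [k _ <-]; exact: psd_ge0.
Qed.

Lemma iter_residual_nonincreasing :
  nonincreasing_seq (fun k => B (T (u k) - u k) (T (u k) - u k)).
Proof.
by apply/nonincreasing_seqP => k; exact: relaxed_step_residual (hlam k) (hu k).
Qed.

(** The Fejer inequalities telescope. *)
Lemma iter_residual_sum p n : T p = p ->
  \sum_(0 <= k < n) lam k * (2 - lam k) * B (T (u k) - u k) (T (u k) - u k)
    <= B (u 0%N - p) (u 0%N - p).
Proof.
move=> Tp.
suff : B (u n - p) (u n - p) +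
    \sum_(0 <= k < n) lam k * (2 - lam k) * B (T (u k) - u k) (T (u k) - u k)
    <= B (u 0%N - p) (u 0%N - p).
  by apply: le_trans; rewrite lerDr psd_ge0.
elim: n => [|n IHn]; first by rewrite big_nil addr0.
rewrite big_nat_recr //=; apply: le_trans IHn.
by have := iter_fejer_step n Tp; lra.
Qed.

(** The residuals decrease. If they stayed above some [e > 0], the bound on
    their weighted sum would bound the divergent sum of the weights. *)
Lemma iter_residual_cvg0 p : T p = p ->
  (\sum_(0 <= k <oo) (lam k * (2 - lam k))%:E = +oo)%E ->
  (fun k => B (T (u k) - u k) (T (u k) - u k)) @ \oo --> 0.
Proof.
move=> Tp hsum; set s := fun k => _.
apply/cvgrPdist_lt => e e0.
have [k sk] : exists k, s k < e.
  apply: contrapT => /forallNP big; have {}big k : e <= s k.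
    by rewrite leNgt; apply/negP/big.
  suff : (\sum_(0 <= k <oo) (lam k * (2 - lam k))%:E
      <= (B (u 0%N - p) (u 0%N - p) / e)%:E)%E by rewrite hsum leye_eq.
  apply: lime_le.
    by apply: is_cvg_nneseries => k _ _; rewrite lee_fin relaxation_weight_ge0.
  apply: nearW => n; rewrite sumEFin lee_fin ler_pdivlMr // mulr_suml.
  apply: le_trans (iter_residual_sum n Tp); apply: ler_sum => k _.
  by rewrite ler_wpM2l ?relaxation_weight_ge0 //; exact: big.
apply: filterS (nbhs_infty_ge k) => n kn; rewrite sub0r normrN ger0_norm ?psd_ge0 //.
by apply: le_lt_trans sk; exact: iter_residual_nonincreasing.
Qed.

Hypothesis hsum : (\sum_(0 <= k <oo) (lam k * (2 - lam k))%:E = +oo)%E.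

Lemma iter_residual_pair_cvg0 p w : T p = p ->
  (fun k => B (T (u k) - u k) w) @ \oo --> 0.
Proof.
move=> Tp; apply/cvgrPdist_lt => e e0.
have w1 : 0 < B w w + 1 by rewrite ltr_wpDl ?psd_ge0.
have := iter_residual_cvg0 Tp hsum => /cvgrPdist_lt/(_ (e ^+ 2 / (B w w + 1))).
rewrite divr_gt0 ?exprn_gt0 // => /(_ isT); apply: filterS => k.
rewrite !sub0r !normrN ger0_norm ?psd_ge0 // ltr_pdivlMr // => small.
rewrite -(@ltr_pXn2r _ 2) ?nnegrE ?(ltW e0) // real_normK ?num_real //.
apply: le_lt_trans (psd_cauchy_schwarz hB _ _) (le_lt_trans _ small).
by rewrite ler_wpM2l ?psd_ge0 // lerDl.
Qed.

(** Opial's device: [2 B (u k) (p - q)] is, up to a constant, the difference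
    of the squared distances of [u k] to [q] and to [p], and both converge.
    As the residuals vanish, [T (u k)] can stand in for [u k]. *)
Lemma iter_fixed_pair_cvg p q : T p = p -> T q = q ->
  cvgn (fun k => B (T (u k)) (p - q)).
Proof.
move=> Tp Tq.
have -> : (fun k => B (T (u k)) (p - q)) =
  (fun k => (B (u k - q) (u k - q) - B (u k - p) (u k - p)
             + (B p p - B q q)) / 2 + B (T (u k) - u k) (p - q)).
  apply/funext => k; rewrite !(psdE hB).
  rewrite (psdC hB q (u k)) (psdC hB p (u k)); lra.
apply: is_cvgD; last by apply/cvg_ex; exists 0; exact: iter_residual_pair_cvg0 Tp.
apply: is_cvgMl; apply: is_cvgD; last exact: is_cvg_cst.
by apply: is_cvgB; exact: iter_dist_cvg.
Qed.

End FirmlyNonexpansive.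

(** The errors satisfy [|l - a k.+1| <= q |l - a k| + 2 |l - b k|] with
    [q < 1], a contraction with a vanishing perturbation. *)
Lemma relaxed_average_cvg (R : realType) (lam a b : nat -> R) (l q : R) :
  (forall k, 0 <= lam k <= 2) -> q < 1 -> (forall k, `|1 - lam k| <= q) ->
  (forall k, a k.+1 = a k + lam k * (b k - a k)) ->
  b @ \oo --> l -> a @ \oo --> l.
Proof.
move=> hlam q1 hq ha bl.
have q0 : 0 <= q := le_trans (normr_ge0 _) (hq 0%N).
apply/cvgrPdist_lt => e e0.
have d0 : 0 < (1 - q) * e / 4 by rewrite divr_gt0 // mulr_gt0 ?subr_gt0.
have /cvgrPdist_lt/(_ _ d0)[N _ hN] := bl.
have step k : (N <= k)%N -> `|l - a k.+1| <= q * `|l - a k| + (1 - q) * (e / 2).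
  move=> /hN /ltW /= bk.
  have -> : l - a k.+1 = (1 - lam k) * (l - a k) + lam k * (l - b k).
    by rewrite ha; ring.
  apply: le_trans (ler_normD _ _) _; rewrite !normrM; apply: lerD.
    by rewrite ler_wpM2r.
  have /andP[l0 l2] := hlam k.
  rewrite ger0_norm //; apply: le_trans (ler_pM l0 _ l2 bk) _ => //; lra.
have decay n : `|l - a (n + N)%N| <= q ^+ n * `|l - a N| + e / 2.
  elim: n => [|n IHn]; first by rewrite expr0 mul1r lerDl divr_ge0 // ltW.
  rewrite addSn; apply: le_trans (step _ (leq_addl _ _)) _.
  have := ler_wpM2l q0 IHn; rewrite exprS; lra.
have /cvgrPdist_lt : geometric `|l - a N| q @ \oo --> 0.
  by apply: cvg_geometric; rewrite ger0_norm.
move=> /(_ (e / 2)); rewrite divr_gt0 // => /(_ isT) [K _ hK].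
apply: filterS (nbhs_infty_ge (K + N)%N) => n Kn.
have Nn : (N <= n)%N by apply: leq_trans Kn; exact: leq_addl.
rewrite -(subnK Nn); apply: le_lt_trans (decay _) _.
have := hK (n - N)%N; rewrite /= leq_subRL // addnC => /(_ Kn).
rewrite sub0r normrN ger0_norm ?mulr_ge0 ?exprn_ge0 // mulrC; lra.
Qed.

(** * Riesz representation *)

Section Hilbert.
Context (R : realType) (H : completeNormedModType R).
Context (dot : {dot H for (@idfun R)}) (hdot : hilbert_inner dot).
Implicit Types (f : H -> R) (x y v p : H).

Lemma dot_psd : psd_form dot.
Proof.
split=> [u v|a u v w|u].
- by rewrite hermC expr0 mul1r.
- by rewrite linearPl.
- have [->|u0] := eqVneq u 0; first by rewrite linear0l.
  by rewrite ltW // neq0_dnorm_gt0.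
Qed.

Lemma sqr_norm_dot u : `|u| ^+ 2 = dot u u.
Proof. by rewrite hdot sqr_sqrtr // psd_ge0 //; exact: dot_psd. Qed.

Lemma dot_le_norm u v : `|dot u v| <= `|u| * `|v|.
Proof.
rewrite -(@ler_pXn2r _ 2) ?nnegrE ?mulr_ge0 // exprMn !sqr_norm_dot.
by rewrite real_normK ?num_real //; exact: psd_cauchy_schwarz dot_psd _ _.
Qed.

Section Riesz.
Context (f : H -> R) (C : R).
Hypothesis flin : forall a u v, f (a *: u + v) = a * f u + f v.
Hypothesis fbd : forall u, `|f u| <= C * `|u|.

(* The energy whose unique minimizer represents [f]. *)
Let J u := `|u| ^+ 2 / 2 - f u.

Let fD u v : f (u + v) = f u + f v.
Proof. by rewrite -{1}[u]scale1r flin mul1r. Qed.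

Let f0 : f 0 = 0.
Proof. by apply: (@addrI _ (f 0)); rewrite -fD !addr0. Qed.

Let fZ a u : f (a *: u) = a * f u.
Proof. by rewrite -[a *: u]addr0 flin f0 addr0. Qed.

Let fB u v : f (u - v) = f u - f v.
Proof. by rewrite fD -scaleN1r fZ mulN1r. Qed.

Let energy_lb u : - (C ^+ 2 / 2) <= J u.
Proof.
have := fbd u; have := ler_norm (f u); rewrite /J.
have := sqr_ge0 (`|u| - C); lra.
Qed.

Let m := inf (range J).

Let m_le u : m <= J u.
Proof.
by apply: ge_inf; [exists (- (C ^+ 2 / 2)) => _ [v _ <-]; exact: energy_lb|exists u].
Qed.

(* The parallelogram identity: minimizing sequences are Cauchy. *)
Let energy_gap u v : `|u - v| ^+ 2 / 4 <= (J u - m) + (J v - m).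
Proof.
have := m_le (2^-1 *: (u + v)).
rewrite /J fZ fD !sqr_norm_dot !(psdE dot_psd) (psdC dot_psd v u); lra.
Qed.

Let f_continuous : continuous f.
Proof.
move=> x; apply/cvgrPdist_lt => e e0.
have C1 : 0 < `|C| + 1 by rewrite ltr_wpDl.
near=> y.
rewrite -fB; apply: le_lt_trans (fbd _) _.
apply: (@le_lt_trans _ _ ((`|C| + 1) * `|x - y|)).
  by rewrite ler_wpM2r // (le_trans (ler_norm C)) // lerDl.
rewrite mulrC -ltr_pdivlMr //.
near: y; apply: cvgr_dist_lt; first exact: cvg_id.
by rewrite divr_gt0.
Unshelve. all: by end_near. Qed.

(** A minimizing sequence of the energy [J] converges by completeness, and
    at its limit [p] the first variation [dot p v - f v] vanishes in every
    direction [v]. *)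
Lemma riesz_representation : exists p, forall v, f v = dot p v.
Proof.
have /choice[x xP] n : exists x, J x < m + n.+1%:R^-1.
  apply: contrapT => /forallNP big.
  have : m + n.+1%:R^-1 <= m.
    apply: lb_le_inf => [|_ [y _ <-]]; first by exists (J 0), 0.
    by rewrite leNgt; apply/negP/big.
  by rewrite gerDl leNgt invr_gt0 ltr0n.
have xcauchy : cauchy (x @ \oo).
  apply: cauchy_exP => e e0.
  have e8 : 0 < e ^+ 2 / 8 by rewrite divr_gt0 // exprn_gt0.
  have [N _ /(_ N (leqnn N)) hN] := near_infty_natSinv_lt (PosNum e8).
  have {}hN : N.+1%:R^-1 < e ^+ 2 / 8 := hN.
  exists (x N); apply: filterS (nbhs_infty_ge N) => n Nn.
  rewrite -ball_normE /ball_ /= -(@ltr_pXn2r _ 2) ?nnegrE ?(ltW e0) //.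
  have : (n.+1%:R^-1 : R) <= N.+1%:R^-1 by rewrite lef_pV2 ?posrE ?ltr0n // ler_nat.
  have := energy_gap (x N) (x n); have := xP N; have := xP n.
  move: (J _) (J _) m (_ ^+ 2) (_ ^+ 2) (N.+1%:R^-1) hN (n.+1%:R^-1) => *; lra.
have /cauchy_cvgP/cvg_ex[p xp] := xcauchy.
have Jx : J \o x @ \oo --> J p.
  apply: cvgB; last exact: (cvg_comp _ _ xp (@f_continuous p)).
  by apply: cvgMl; rewrite /= expr2; apply: cvgM; exact: cvg_norm.
have Jp : J p <= m.
  apply: (ler_cvg_to Jx (_ : (fun n => m + harmonic n) @ \oo --> m)).
    by rewrite -[X in _ --> X]addr0; apply: cvgD; [exact: cvg_cst|exact: cvg_harmonic].
  by apply: nearW => n; exact: ltW (xP n).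
exists p => v; apply/eqP; rewrite -subr_eq0.
set c := f v - dot p v.
(* The right-hand side is [J (p + t *: v) - J p]. *)
have min t : 0 <= t ^+ 2 / 2 * dot v v - t * c.
  have := le_trans Jp (m_le (p + t *: v)).
  rewrite /J fD fZ !sqr_norm_dot !(psdE dot_psd) (psdC dot_psd v p) /c; lra.
have vv : 0 <= dot v v by apply: psd_ge0 dot_psd _.
(* The denominator [1 + dot v v] in place of [dot v v] covers [v = 0], and
   still makes the quadratic negative unless [c = 0]. *)
have D1 : 1 + dot v v != 0 by rewrite gt_eqF // ltr_wpDr.
have -> : c = c / (1 + dot v v) * (1 + dot v v) by rewrite divfK.
have := min (c / (1 + dot v v)).
rewrite -[X in _ - _ * X](divfK D1).
set t := c / _ => ht.
have tD : 0 <= t ^+ 2 * dot v v by rewrite mulr_ge0 ?sqr_ge0.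
have : t ^+ 2 <= 0 by lra.
by rewrite real_exprn_even_le0 ?num_real //= => /eqP ->; rewrite mul0r.
Qed.

End Riesz.

(** * Weak cluster points of bounded sequences *)

(** [weak_cvgP] for arbitrary filters: cluster points of a sequence are limits
    of finer filters, which need not come from subsequences. *)
Lemma weak_cvg_filterP (F : set_system (weak_topology dot)) (l : H) : Filter F ->
  F --> (l : weak_topology dot) <-> forall v, dot^~ v @ F --> dot l v.
Proof.
move=> FF; pose f (u : H) : {ptws H -> R} := dot u.
split=> [Fl v|Fl].
  have fl : f @ F --> f l := cvg_comp _ _ Fl (@initial_continuous _ _ f l).
  by have /pointwise_cvgP/(_ v) := fl.
move=> A; rewrite nbhsE => -[_ [[B oB <-] Bl] sBA].
apply: (filterS sBA).
have : {ptws, f @ F --> f l} by apply/pointwise_cvgP.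
by apply; exact: open_nbhs_nbhs.
Qed.

Lemma weak_cluster_dot (x : nat -> H) p v (c : R) :
  weak_cluster dot x p -> (fun k => dot (x k) v) @ \oo --> c -> dot p v = c.
Proof.
rewrite /weak_cluster cluster_cvgE => -[G PG [Gp xG]] xc.
have Gc : dot^~ v @ G --> c by move=> A /xc; exact: xG.
exact: cvg_unique ((weak_cvg_filterP _ _).1 Gp v) Gc.
Qed.

(** Along an ultrafilter each bounded real sequence [k |-> dot (x k) v] has a
    limit. These limits form a bounded linear functional of [v], which
    Riesz represents by a vector. *)
Lemma weak_ultra_cluster (x : nat -> H) (C : R) (U : set_system nat) :
  (forall k, `|x k| <= C) -> UltraFilter U -> \oo `<=` U ->
  exists2 p, weak_cluster dot x p & forall v, dot (x k) v @[k --> U] --> dot p v.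
Proof.
move=> xC UU ooU.
have x_bd v k : `|dot (x k) v| <= C * `|v|.
  by apply: le_trans (dot_le_norm _ _) _; rewrite ler_wpM2r.
have lim_ v : exists l : R, dot (x k) v @[k --> U] --> l.
  have [|l [_ lU]] :=
    @segment_compact _ (- (C * `|v|)) (C * `|v|) (dot (x k) v @[k --> U]).
    by apply: nearW => k /=; rewrite in_itv /= -ler_norml.
  exists l => A Al.
  have [//|nA] := in_ultra_setVsetC ((fun k => dot (x k) v) @^-1` A) UU.
  by have [y []] := lU (~` A) A nA Al.
have /choice[f fP] := lim_.
have [||p fp] := @riesz_representation f C.
- move=> a y z; apply: cvg_unique (fP _) _ => //.
  have -> : (fun k => dot (x k) (a *: y + z)) =
            (fun k => a * dot (x k) y + dot (x k) z).
    by apply/funext => k; rewrite linearPr.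
  exact: cvgD (cvgM (cvg_cst a) (fP y)) (fP z).
- move=> y; apply: (ler_cvg_to (cvg_norm (fP y)) (cvg_cst (C * `|y|))).
  exact: nearW.
have xp v : dot (x k) v @[k --> U] --> dot p v by rewrite -fp.
exists p => //; rewrite /weak_cluster cluster_cvgE.
exists ((x : nat -> weak_topology dot) @ U); first exact: fmap_proper_filter.
split; first exact/weak_cvg_filterP.
by move=> A /ooU.
Qed.

(** If [x] failed to converge to its only cluster point [p], some
    neighbourhood of [dot p v] would be missed frequently. An ultrafilter
    concentrated on the indices that miss it yields a cluster point other
    than [p]. *)
Lemma weak_cvg_unique_cluster (x : nat -> H) (C : R) :
  (forall k, `|x k| <= C) ->
  (forall p q, weak_cluster dot x p -> weak_cluster dot x q -> p = q) ->
  exists2 p, weak_cluster dot x p & weak_cvg dot x p.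
Proof.
move=> xC x1.
have [U [UU ooU]] := ultraFilterLemma (eventually_filter : ProperFilter \oo).
have [p xp _] := weak_ultra_cluster xC UU ooU.
exists p => //; apply/weak_cvgP => v A Ap.
apply: contrapT => nA; pose B := (fun k => dot (x k) v) @^-1` A.
have PB : ProperFilter (within (~` B) \oo).
  split; last exact: within_filter.
  by rewrite /within /= => hB; apply: nA; apply: filterS hB => k /contrapT.
have [W [UW BW]] := ultraFilterLemma PB.
have ooW : \oo `<=` W by move=> D oD; apply: BW; apply: filterS oD => k Dk _.
have [q xq qW] := weak_ultra_cluster xC UW ooW.
have WB : W B by apply: (qW v); rewrite (x1 q p).
have WnB : W (~` B) by apply: BW; apply: nearW => k.
by have [k []] := filter_ex (filterI WB WnB).
Qed.

End Hilbert.

(** * The preconditioned proximal point map *)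

Section Preconditioner.
Context (R : realType) (H : completeNormedModType R).
Context (dot : {dot H for (@idfun R)}) (hdot : hilbert_inner dot).
Context (A : H -> set H) (M : {linear H -> H}) (hM : admissible dot M A).
Context (T : H -> H) (hT : forall u, ppp_op M A u = [set T u]).

Definition mform (u v : H) : R := dot (M u) v.

Lemma mform_psd : psd_form mform.
Proof.
case: hM => _ Msym Mpos _; split=> [u v|a u v w|u]; last exact: Mpos.
- by rewrite /mform Msym (psdC (dot_psd dot)).
- by rewrite /mform linearP linearPl.
Qed.

(** Cauchy-Schwarz for [mform] between [x] and [M x] gives
    [|M x|^4 <= mform x x * mform (M x) (M x)], and boundedness of [M] turns
    the last factor into a multiple of [|M x|^2]. So the seminorm of [x]
    controls the norm of [M x], although not that of [x]. *)
Lemma precond_norm_le :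
  exists2 C : R, 0 <= C & forall x, `|M x| ^+ 2 <= C * mform x x.
Proof.
case: hM => -[C MC] _ _ _; exists `|C| => // x.
have [->|Mx0] := eqVneq (M x) 0.
  by rewrite normr0 expr0n mulr_ge0 ?(psd_ge0 mform_psd).
have Mx2 : 0 < `|M x| ^+ 2 by rewrite exprn_gt0 // normr_gt0.
have := psd_cauchy_schwarz mform_psd x (M x).
rewrite {1}/mform -(sqr_norm_dot hdot) expr2 => cs.
rewrite -(ler_pM2r Mx2); apply: le_trans cs _.
rewrite mulrAC [leRHS]mulrC; apply: ler_wpM2l; first exact: psd_ge0 mform_psd _.
apply: le_trans (ler_norm _) _; apply: le_trans (dot_le_norm hdot _ _) _.
rewrite expr2 mulrA ler_wpM2r //; apply: le_trans (MC _) _.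
by rewrite ler_wpM2r // ler_norm.
Qed.

Lemma ppp_incl u : A (T u) (M (u - T u)).
Proof.
have : ppp_op M A u (T u) by rewrite hT.
by move=> [a Aa]; rewrite linearB => <-; rewrite addrC addKr.
Qed.

(** [(T u, u - T u)] lies in the graph of [M^-1 A], on which monotonicity of
    that operator is firmness of [T]. *)
Lemma ppp_firmly_nonexpansive :
  pmonotone dot M (pinv_op M A) -> firmly_nonexpansive mform T.
Proof.
move=> hmono x y; rewrite (psdC mform_psd).
exact: hmono (ppp_incl x) (ppp_incl y).
Qed.

Lemma zer_fix z : zer A z -> T z = z.
Proof.
move=> Az; have : ppp_op M A z z by exists 0; rewrite ?addr0.
by rewrite hT.
Qed.

Lemma ppp_lipschitz (L : R) x y : lipschitz_op L (resolvent M A) ->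
  `|T x - T y| <= L * `|M (x - y)|.
Proof.
move=> hL; rewrite linearB; have res z : resolvent M A (M z) (T z).
  by have : ppp_op M A z (T z) by rewrite hT.
exact: hL.
Qed.

End Preconditioner.

Theorem theorem2p9 (R : realType) (H : completeNormedModType R)
    (dot : {dot H for (@idfun R)}) (hdot : hilbert_inner dot)
    (A : H -> set H) (hA : zer A !=set0)
    (M : {linear H -> H}) (hM : admissible dot M A)
    (hmono : pmonotone dot M (pinv_op M A))
    (L : R) (hL : lipschitz_op L (resolvent M A))
    (T : H -> H) (hT : forall u, ppp_op M A u = [set T u])
    (lam : nat -> R) (hlam : forall k, 0 <= lam k <= 2)
    (hsum : (\sum_(0 <= k <oo) (lam k * (2 - lam k))%:E = +oo)%E)
    (u0 : H) (u : nat -> H) (hu0 : u 0%N = u0)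
    (hu : forall k, u k.+1 = u k + lam k *: (T (u k) - u k))
    (hcluster : weak_cluster dot (fun k => T (u k)) `<=` fix_set T) :
  exists ustar : H,
    [/\ fix_set T ustar,
        weak_cvg dot (fun k => T (u k)) ustar &
        0 < inf (range lam) -> sup (range lam) < 2 -> weak_cvg dot u ustar].
Proof.
have mpsd := mform_psd hM.
have hfirm := ppp_firmly_nonexpansive hM hT hmono.
have [C C0 MC] := precond_norm_le hdot hM.
have Tlip x y := ppp_lipschitz hT x y hL.
have [z0 Az0] := hA; have Tz0 := zer_fix hT Az0.
have Tu_bounded k :
    `|T (u k)| <= `|z0| + `|L| * Num.sqrt (C * mform dot M (u 0%N - z0) (u 0%N - z0)).
  have -> : T (u k) = z0 + (T (u k) - T z0) by rewrite Tz0 addrC subrK.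
  apply: le_trans (ler_normD _ _) _; rewrite lerD2l.
  apply: le_trans (Tlip _ _) _.
  apply: le_trans (ler_wpM2r (normr_ge0 _) (ler_norm L)) _.
  rewrite ler_wpM2l // -[leLHS]normr_id -sqrtr_sqr ler_wsqrtr //.
  apply: le_trans (MC _) _; rewrite ler_wpM2l //.
  exact: (iter_fejer mpsd hfirm hlam hu Tz0 (leq0n k)).
have cluster_eq p q : weak_cluster dot (fun k => T (u k)) p ->
    weak_cluster dot (fun k => T (u k)) q -> p = q.
  move=> xp xq; have Tp := hcluster _ xp; have Tq := hcluster _ xq.
  have /cvg_ex[c cP] := iter_fixed_pair_cvg mpsd hfirm hlam hu hsum Tp Tq.
  have {}cP : (fun k => dot (T (u k)) (M (p - q))) @ \oo --> c.
    have [_ Msym _ _] := hM.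
    by under eq_fun do rewrite -Msym.
  have pq0 : mform dot M (p - q) (p - q) = 0.
    rewrite /mform (psdC (dot_psd dot)) (psdDl (dot_psd dot)).
    rewrite (psdNl (dot_psd dot)).
    by rewrite (weak_cluster_dot xp cP) (weak_cluster_dot xq cP) subrr.
  (* Fixed points at seminorm distance 0 coincide, since [T] factors through
     [M]. *)
  have Mpq : `|M (p - q)| = 0.
    apply/eqP; rewrite -sqrf_eq0 eq_le sqr_ge0 andbT.
    by apply: le_trans (MC _) _; rewrite pq0 mulr0.
  have := Tlip p q; rewrite Tp Tq Mpq mulr0 normr_le0 subr_eq0.
  by move/eqP.
have [p xp Tu_p] := weak_cvg_unique_cluster hdot Tu_bounded cluster_eq.
exists p; split=> // [|inf_gt0 sup_lt2]; first exact: hcluster.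
(* [|1 - l| <= q] means that [l] lies between [1 - q] and [1 + q]. *)
pose q := Num.max (1 - inf (range lam)) (sup (range lam) - 1).
have q1 : q < 1 by rewrite /q gt_max; apply/andP; split; lra.
have lam_q k : `|1 - lam k| <= q.
  have lam_ge : inf (range lam) <= lam k.
    by apply: ge_inf; [exists 0 => _ [j _ <-]; have /andP[] := hlam j|exists k].
  have lam_le : lam k <= sup (range lam).
    by apply: ub_le_sup; [exists 2 => _ [j _ <-]; have /andP[] := hlam j|exists k].
  by rewrite ler_norml /q lerNl !le_max; apply/andP; split; apply/orP;
    [right|left]; lra.
apply/weak_cvgP => v.
have /weak_cvgP/(_ v) := Tu_p.
apply: (relaxed_average_cvg hlam q1 lam_q) => k.
by rewrite hu !(psdE (dot_psd dot)).
Qed.
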